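(* For every integer $k \geq 2$, the $k$-anagram-free chromatic number is unbounded on graphs of maximum degree $k+1$; that is, for every integer $k\geq 2$ and every positive integer $c$ there exists a graph $G$ with maximum degree $\Delta(G)=k+1$ such that $\phi_k(G) > c$.
   Context: Graphs are finite, simple and undirected. For $k\geq 2$, a $k$-anagram is a word $W_1W_2\cdots W_k$ where each $W_i$ is a permutation of one common non-empty word $W$ (i.e. each symbol occurs equally often in all the $W_i$). A vertex colouring of a graph $G$ is a function $f:V(G)\to C$ where $C$ is a set of colours (no properness is assumed). A vertex colouring of $G$ is $k$-anagram-free if for every path $v_1,\dots,v_n$ that is a subgraph of $G$ (not necessarily induced), the sequence of colours $f(v_1)\cdots f(v_n)$ is not a $k$-anagram. The $k$-anagram-free chromatic number $\phi_k(G)$ is the minimum number of colours in a $k$-anagram-free vertex colouring of $G$. *)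

(* Defs.v *)
From mathcomp Require Import all_boot.
From mathcomp Require Import boolp.

Set Implicit Arguments.
Unset Strict Implicit.
Unset Printing Implicit Defensive.

Record sgraph := SGraph {
  vertex :> finType;
  adj : rel vertex;
  adj_sym : symmetric adj;
  adj_irr : irreflexive adj }.

Definition degree (G : sgraph) (x : G) : nat := #|[set y : G | adj x y]|.

Definition max_degree (G : sgraph) : nat := \max_(x : G) degree x.

(* The vertex sequence of a not necessarily induced path. *)
Definition gpath (G : sgraph) (s : seq G) : bool := uniq s && sorted (@adj G) s.

Definition kanagram (k : nat) (C : eqType) (w : seq C) : Prop :=
  exists (W : seq C) (Ws : seq (seq C)),
    [/\ W != [::], size Ws = k, all (perm_eq W) Ws & w = flatten Ws].

Definition anagram_free (k : nat) (G : sgraph) (C : eqType) (f : G -> C) : Prop :=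
  forall s : seq G, gpath s -> ~ kanagram k (map f s).

Definition anagram_free_colourable (k : nat) (G : sgraph) (c : nat) : Prop :=
  exists f : G -> 'I_c, anagram_free k f.

Lemma anagram_free_inj (k : nat) (G : sgraph) (C : eqType) (f : G -> C) :
  2 <= k -> injective f -> anagram_free k f.
Proof.
move=> hk f_inj s /andP[s_uniq _] [W [[|W1 [|W2 Ws]] [W_neq0 szWs hWs def_s]]].
- by rewrite -szWs in hk.
- by rewrite -szWs in hk.
move: s_uniq; rewrite -(map_inj_uniq f_inj) def_s /= catA => /[!cat_uniq].
case/andP => /and3P[_ /hasPn disj _] _.
case/and3P: hWs => /perm_mem eq1 /perm_mem eq2 _.
case: W W_neq0 eq1 eq2 => // a W _ eq1 eq2.
have aW : a \in a :: W by rewrite mem_head.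
by have := disj a; rewrite /= -eq1 -eq2 aW => /(_ isT).
Qed.

Lemma anagram_free_colourable_ex (k : nat) (G : sgraph) :
  2 <= k -> exists c, `[< anagram_free_colourable k G c >].
Proof.
move=> hk; exists #|G|; apply/asboolP; exists (@enum_rank G).
by apply: anagram_free_inj hk _; apply: enum_rank_inj.
Qed.

(* phi_k(G). The bound on k is needed for the minimum to exist: no colouring
   of a graph with a vertex is 1-anagram-free. *)
Definition anagram_free_chromatic_number (k : nat) (hk : 2 <= k) (G : sgraph) : nat :=
  ex_minn (anagram_free_colourable_ex G hk).

(* Main.v *)
Require Import Defs.
From mathcomp Require Import all_boot.
From mathcomp Require Import boolp.
From mathcomp Require Import zify.

Set Implicit Arguments.
Unset Strict Implicit.
Unset Printing Implicit Defensive.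

(** Build graphs L_0, L_1, ..., each with two tips, a lower one and an upper
    one. L_0 is an edge. L_(h+1) consists of k disjoint copies of L_h, two hubs
    and two new tips: the lower hub together with the lower tips of the k copies
    forms a clique, and carries the new lower tip as a pendant vertex; likewise
    for the upper side. So L_h is a k-ary tree of cliques whose leaves are joined
    to those of its mirror image. Tips of L_h have degree 1, and after becoming
    part of a clique on k+1 vertices they have degree k+1, as every other
    vertex does ([degree_lens]).

    Choosing a copy at each level gives k^h routes of 4h+2 vertices from the
    lower to the upper tip of L_h. Suppose L_h is coloured without k-anagrams.
    Then a fixed multiset of colours occurs on at most (k-1)^h routes
    ([fibre_bound]): all routes of L_(h+1) share the colours of the tips and
    hubs, so routes with equal multisets restrict to routes of the copies with
    equal multisets. If each of the k copies contained one of them, these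
    restrictions could be traversed alternately upwards and downwards, passing
    from copy to copy inside the two cliques, and this path is a k-anagram
    ([snake_gpath], [snake_kanagram]). Hence some copy contributes nothing, and
    induction bounds the others.

    With c colours there are at most (4h+3)^c multisets, so
    k^h <= (4h+3)^c (k-1)^h ([routes_le]), which is false for large h
    ([exponential_gap]). *)

(** * The graphs and their degrees *)

(** Of the two new pairs of vertices in [bool * bool], the first bit is the side
    (false for lower, true for upper) and the second tells tips (true) from hubs
    (false). *)
Fixpoint lens (k h : nat) : finType :=
  if h is h'.+1 then ((bool * bool) + ('I_k * lens k h'))%type else bool.

Definition tip (k h : nat) (b : bool) : lens k h :=
  match h with 0 => b | h'.+1 => inl (b, true) end.

Definition hub (k h : nat) (b : bool) : lens k h.+1 := inl (b, false).

Fixpoint ladj (k h : nat) : rel (lens k h) :=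
  match h return rel (lens k h) with
  | 0 => fun x y => x != y
  | h'.+1 => fun x y =>
    match x, y with
    | inl (b, u), inl (b', u') => (b == b') && (u != u')
    | inl (b, u), inr (_, v) | inr (_, v), inl (b, u) =>
        ~~ u && (v == tip k h' b)
    | inr (i, v), inr (j, w) =>
        if i == j then ladj v w
        else [exists b, (v == tip k h' b) && (w == tip k h' b)]
    end
  end.

Lemma ladj_sym k h : symmetric (@ladj k h).
Proof.
elim: h => [|h IHh]; first by move=> x y /=; rewrite eq_sym.
move=> [[b u]|[i v]] [[b' u']|[j w]] //=; first by rewrite eq_sym (eq_sym u).
rewrite eq_sym; case: eqP => // _.
by apply: eq_existsb => b; rewrite andbC.
Qed.

Lemma ladj_irr k h : irreflexive (@ladj k h).
Proof.
elim: h => [|h IHh]; first by move=> x /=; rewrite eqxx.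
by move=> [[b u]|[i v]] /=; rewrite !eqxx.
Qed.

Definition lens_graph k h : sgraph := SGraph (@ladj_sym k h) (@ladj_irr k h).

Lemma tip_inj k h : injective (tip k h).
Proof. by case: h => [|h] b b' // [->]. Qed.

Lemma degree_sum (G : sgraph) (x : G) : degree x = \sum_(y : G) adj x y.
Proof.
rewrite /degree -sum1_card big_mkcond /=.
by apply: eq_bigr => y _; rewrite inE; case: (adj x y).
Qed.

Lemma sum_tip_eq k h (v : lens k h) :
  \sum_(b : bool) (v == tip k h b) = (v \in codom (tip k h)).
Proof.
case: codomP => [[b ->]|no_tip].
  rewrite (bigD1 b) //= eqxx big1 // => b' neq.
  by rewrite (inj_eq (@tip_inj k h)) eq_sym (negPf neq).
by rewrite big1 // => b _; case: eqP => // def_v; case: no_tip; exists b.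
Qed.

Lemma exists_tip_eq k h (v w : lens k h) :
  [exists b, (v == tip k h b) && (w == tip k h b)]
    = (v \in codom (tip k h)) && (v == w).
Proof.
apply/existsP/andP => [[b /andP[/eqP-> /eqP->]]|[/codomP[b ->] /eqP<-]].
  by split=> //; apply: codom_f.
by exists b; rewrite eqxx.
Qed.

Lemma sum_lens k h (F : lens k h.+1 -> nat) :
  \sum_x F x = \sum_(b : bool) \sum_(u : bool) F (inl (b, u))
              + \sum_(i : 'I_k) \sum_(v : lens k h) F (inr (i, v)).
Proof.
rewrite big_sumType !pair_bigA; congr (_ + _).
  by apply: eq_bigr => -[].
by apply: eq_bigr => -[].
Qed.

(** Passing from L_h to L_(h+1), a tip of a copy gains the hub and the k-1
    corresponding tips of the other copies, and no other old vertex gains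
    anything. *)
Lemma degree_lens k h (v : lens_graph k h) :
  degree v = if v \in codom (tip k h) then 1 else k.+1.
Proof.
rewrite degree_sum; elim: h v => [|h IHh] /= v.
  have -> : v \in codom (tip k 0) by apply/codomP; exists v.
  by rewrite big_bool; case: v.
rewrite sum_lens.
case: v => [[b u]|[i v]] /=.
  under [X in _ + X]eq_bigr => j _.
    rewrite (bigD1 (tip k h b)) //= eqxx andbT big1 ?addn0; last first.
      by move=> w /negPf->; rewrite andbF.
    over.
  rewrite sum_nat_const card_ord !big_bool /=.
  have -> : inl (b, u) \in codom (tip k h.+1) = u.
    by apply/codomP/idP => [[b' [_ ->]] //|->]; exists b.
  by case: b u => [] [] /=; rewrite ?muln0 ?muln1.
have /negPf-> : inr (i, v) \notin codom (tip k h.+1) by apply/codomP => -[b].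
rewrite (bigD1 i) //= eqxx IHh.
under [X in _ + (_ + X)]eq_bigr => j neq_ji.
  rewrite eq_sym (negPf neq_ji).
  under eq_bigr => w _ do rewrite exists_tip_eq.
  rewrite (bigD1 v) //= eqxx andbT big1 ?addn0; last first.
    by move=> w; rewrite eq_sym => /negPf->; rewrite andbF.
  over.
rewrite sum_nat_const cardC1 card_ord.
under eq_bigr => b _ do rewrite big_bool /= add0n.
rewrite sum_tip_eq; have := ltn_ord i; case: (v \in _) => /=; lia.
Qed.

Lemma max_degree_lens k h : max_degree (lens_graph k h.+1) = k.+1.
Proof.
apply/eqP; rewrite eqn_leq; apply/andP; split.
  by apply/bigmax_leqP => v _; rewrite degree_lens; case: ifP.
have := @leq_bigmax (lens_graph k h.+1) (@degree _) (hub k h true).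
rewrite degree_lens ifN //; apply/codomP => -[b] [] //.
Qed.

(** * Routes between the tips *)

Definition inner k h (i : 'I_k) (v : lens k h) : lens k h.+1 := inr (i, v).

Definition extend k h (i : 'I_k) (p : seq (lens k h)) : seq (lens k h.+1) :=
  [:: tip k h.+1 false; hub k h false] ++ map (inner i) p
    ++ [:: hub k h true; tip k h.+1 true].

Fixpoint routes k h : seq (seq (lens k h)) :=
  match h return seq (seq (lens k h)) with
  | 0 => [:: [:: false; true]]
  | h'.+1 => [seq extend i p | i <- enum 'I_k, p <- routes k h']
  end.

Lemma size_routes k h : size (routes k h) = k ^ h.
Proof.
by elim: h => // h IHh; rewrite size_allpairs IHh size_enum_ord expnS.
Qed.

Lemma size_route k h p : p \in routes k h -> size p = 4 * h + 2.
Proof.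
elim: h p => [|h IHh] p /=; first by rewrite inE => /eqP->.
case/allpairsP=> -[i q] [_ /= /IHh sz_q ->].
rewrite /extend !size_cat size_map sz_q /=; lia.
Qed.

Lemma inner_inj k h i : injective (@inner k h i).
Proof. by move=> v w []. Qed.

(** Simple paths from the tip on side [b] to the opposite tip, with the starting
    point displayed so that such paths can be concatenated. *)
Definition tip_path k h (b : bool) (p : seq (lens k h)) :=
  exists q, [/\ p = tip k h b :: q, last (tip k h b) q = tip k h (~~ b),
                path (@ladj k h) (tip k h b) q & uniq p].

Lemma tip_path_rev k h b (p : seq (lens k h)) : tip_path b p -> tip_path (~~ b) (rev p).
Proof.
case=> q [-> last_q path_q uniq_p]; exists (rev (belast (tip k h b) q)).
rewrite rev_uniq lastI rev_rcons last_q; split=> //.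
- case: q last_q {path_q uniq_p} => [|x q] /= ; first by move/tip_inj; case: b.
  by rewrite rev_cons last_rcons negbK.
- by rewrite -last_q rev_path; under eq_path do rewrite /= ladj_sym.
- by rewrite -last_q -lastI.
Qed.

Lemma map_inner_path k h i b (p : seq (lens k h)) : tip_path b p ->
  exists q, [/\ map (inner i) p = inner i (tip k h b) :: q,
    last (inner i (tip k h b)) q = inner i (tip k h (~~ b)),
    path (@ladj k h.+1) (inner i (tip k h b)) q & uniq (map (inner i) p)].
Proof.
case=> q [-> last_q path_q uniq_p]; exists (map (inner i) q).
rewrite last_map last_q (map_inj_uniq (@inner_inj k h i)); split=> //.
by rewrite path_map; under eq_path do rewrite /= eqxx.
Qed.

Lemma route_path k h p : p \in routes k h -> tip_path false p.
Proof.
elim: h p => [|h IHh] p /=; first by rewrite inE => /eqP->; exists [:: true].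
case/allpairsP=> -[i q] [_ /= /IHh /(map_inner_path i) [r [def_r last_r path_r uniq_r]] ->].
rewrite /extend; eexists; split; first reflexivity.
- by rewrite /= last_cat.
- rewrite def_r /= !eqxx /= cat_path path_r last_r /= !eqxx //.
- rewrite /= cat_uniq uniq_r /= !inE !mem_cat !inE /= andbT.
  by rewrite !negb_or /= ; repeat (apply/andP; split=> //); apply/mapP => -[].
Qed.

(** * A path through all copies *)

(** The pieces visited copy after copy in the order [s], the first one starting
    on side [b]. Pieces are reversed alternately, because the path leaves a copy
    on the side opposite to the one on which it entered. *)
Fixpoint snake k h (P : 'I_k -> seq (lens k h)) (b : bool) (s : seq 'I_k) :
    seq (seq (lens k h.+1)) :=
  if s is i :: s' then
    map (inner i) (if b then rev (P i) else P i) :: snake P (~~ b) s'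
  else [::].

Lemma size_snake k h (P : 'I_k -> seq (lens k h)) b s : size (snake P b s) = size s.
Proof. by elim: s b => //= i s IHs b; rewrite IHs. Qed.

Lemma mem_snake k h (P : 'I_k -> seq (lens k h)) b s i v :
  inner i v \in flatten (snake P b s) -> i \in s.
Proof.
elim: s b => //= j s IHs b; rewrite mem_cat inE => /orP[/mapP[w _ [-> _]]|/IHs->].
  by rewrite eqxx.
by rewrite orbT.
Qed.

Lemma snake_piece k h (i : 'I_k) (p : seq (lens k h)) b : tip_path false p ->
  exists q, [/\ map (inner i) (if b then rev p else p) = inner i (tip k h b) :: q,
    last (inner i (tip k h b)) q = inner i (tip k h (~~ b)),
    path (@ladj k h.+1) (inner i (tip k h b)) q
    & uniq (map (inner i) (if b then rev p else p))].
Proof.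
by move=> path_p; apply: map_inner_path; case: b => //; apply: tip_path_rev path_p.
Qed.

(** Starting from a vertex [x] outside makes the induction uniform: [x] is either
    a hub or the tip at which the previous copy is left. *)
Lemma snake_path k h (P : 'I_k -> seq (lens k h)) b s x :
    (forall i, tip_path false (P i)) ->
    uniq s -> (forall i, i \in s -> ladj x (inner i (tip k h b))) ->
  path (@ladj k h.+1) x (flatten (snake P b s)).
Proof.
move=> path_P; elim: s b x => //= i s IHs b x /andP[i_notin_s uniq_s] adj_x.
have [q [-> last_q path_q _]] := snake_piece i b (path_P i).
rewrite /= adj_x ?mem_head // cat_path path_q last_q /=.
apply: IHs => // j j_s /=.
rewrite ifN; last by apply: contraNneq i_notin_s => ->.
by apply/existsP; exists (~~ b); rewrite !eqxx.
Qed.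

Lemma snake_uniq k h (P : 'I_k -> seq (lens k h)) b s :
  (forall i, tip_path false (P i)) -> uniq s -> uniq (flatten (snake P b s)).
Proof.
move=> path_P; elim: s b => //= i s IHs b /andP[i_notin_s uniq_s].
have [q [_ _ _ uniq_i]] := snake_piece i b (path_P i).
rewrite cat_uniq uniq_i IHs // andbT /=.
apply/hasPn => x x_snake; apply: contra i_notin_s => /mapP[v _ def_x].
by apply: (@mem_snake k h P (~~ b) s i v); rewrite -def_x.
Qed.

Lemma snake_gpath k h (P : 'I_k -> seq (lens k h)) s :
    (forall i, tip_path false (P i)) -> uniq s ->
  @gpath (lens_graph k h.+1) (flatten (snake P false s)).
Proof.
move=> path_P uniq_s; rewrite /gpath snake_uniq //=.
apply: (@path_sorted _ _ (hub k h false)); apply: snake_path => // i _ /=.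
exact: eqxx.
Qed.

(** * Routes with a given colour multiset *)

Lemma snake_kanagram k h (C : eqType) (f : lens_graph k h.+1 -> C)
    (P : 'I_k -> seq (lens k h)) W :
    W != [::] -> (forall i, perm_eq W [seq f (inner i v) | v <- P i]) ->
  kanagram k (map f (flatten (snake P false (enum 'I_k)))).
Proof.
move=> W_neq0 eqW; exists W, (map (map f) (snake P false (enum 'I_k))).
rewrite size_map size_snake size_enum_ord map_flatten; split=> //.
elim: (enum _) false => //= i s IHs b; rewrite IHs andbT -map_comp.
apply: (perm_trans (eqW i)); case: b => //.
by rewrite map_rev perm_sym perm_rev.
Qed.

Lemma anagram_free_inner k h (C : eqType) (f : lens_graph k h.+1 -> C) (i : 'I_k) :
  anagram_free k f -> @anagram_free k (lens_graph k h) C (f \o inner i).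
Proof.
move=> free_f s /andP[uniq_s sorted_s]; rewrite map_comp; apply: free_f.
rewrite /gpath (map_inj_uniq (@inner_inj k h i)) uniq_s sorted_map /=.
by under eq_sorted do rewrite /= eqxx.
Qed.

(** The induction works because the k copies cannot all contain a route whose
    extension has colour multiset [W]; this costs one of the k branches at each
    level. *)
Lemma fibre_bound k h (C : eqType) (f : lens_graph k h -> C) W :
    0 < k -> anagram_free k f ->
  count (fun p => perm_eq W (map f p)) (routes k h) <= k.-1 ^ h.
Proof.
move=> k_gt0; elim: h f W => [|h IHh] f W free_f.
  by rewrite expn0; apply: count_size.
(* Sort the routes by the copy that they cross. *)
rewrite count_flatten -map_comp sumnE big_map big_enum /=.
under eq_bigr do rewrite count_map.
set hits := fun (i : 'I_k) (p : seq (lens k h)) => perm_eq W (map f (extend i p)).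
have hits_core i j p q : hits i p -> hits j q ->
    perm_eq (map (f \o inner i) p) (map (f \o inner j) q).
  rewrite /hits => /permPl-> ; rewrite /extend !map_cat perm_cat2l perm_cat2r.
  by rewrite -!map_comp.
have hits_le i : count (hits i) (routes k h) <= k.-1 ^ h.
  have [/hasP[p _ hit_p]|] := boolP (has (hits i) (routes k h)); last first.
    by rewrite has_count lt0n negbK => /eqP->.
  have := IHh _ (map (f \o inner i) p) (anagram_free_inner (i := i) free_f).
  apply: leq_trans.
  by apply: sub_count => q; apply: hits_core.
(* Otherwise one such route per copy could be joined to a k-anagram. *)
have [i miss] : exists i, ~~ has (hits i) (routes k h).
  apply/existsP; apply: contraT; rewrite negb_exists => /forallP all_hit.
  have /fin_all_exists[P hit_P] i : exists p, p \in routes k h /\ hits i p.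
    by have := all_hit i; rewrite negbK => /hasP[p]; exists p.
  pose i0 := Ordinal k_gt0.
  have path_P i : tip_path false (P i) by case: (hit_P i) => /route_path.
  case: (free_f (flatten (snake P false (enum 'I_k)))).
    by apply: snake_gpath => //; apply: enum_uniq.
  apply: (@snake_kanagram _ _ _ _ _ (map (f \o inner i0) (P i0))).
    by case: (path_P i0) => q [->].
  by move=> i; apply: hits_core; [case: (hit_P i0) | case: (hit_P i)].
rewrite (bigD1 i) //= -[count _ _]/(count (hits i) _).
move: miss; rewrite has_count lt0n negbK => /eqP->; rewrite add0n.
apply: leq_trans (leq_sum _ (fun j _ => hits_le j)) _.
by rewrite sum_nat_const cardC1 card_ord expnS.
Qed.

(** * Counting *)

Lemma size_le_fibres (T : Type) (K : finType) (key : T -> K) (s : seq T) B :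
  (forall v, count (fun x => key x == v) s <= B) -> size s <= #|K| * B.
Proof.
move=> le_B; rewrite -sum_nat_const.
apply: leq_trans (leq_sum _ (fun v _ => le_B v)).
rewrite -sum1_size; under [leqRHS]eq_bigr => v _ do rewrite -sum1_count big_mkcond.
rewrite exchange_big /=; apply: leq_sum => x _.
by rewrite (bigD1 (key x)) //= eqxx.
Qed.

(** A colour multiset on a route is encoded by its [c] multiplicities, each at
    most 4h+2, the length of a route. *)
Lemma routes_le k h c (f : lens_graph k h -> 'I_c) :
  0 < k -> anagram_free k f -> k ^ h <= (4 * h + 3) ^ c * k.-1 ^ h.
Proof.
move=> k_gt0 free_f; rewrite -size_routes.
pose key p := [ffun x => inord (count_mem x (map f p))] : {ffun 'I_c -> 'I_(4 * h + 2).+1}.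
have -> : 4 * h + 3 = (4 * h + 2).+1 by lia.
have <- : #|{ffun 'I_c -> 'I_(4 * h + 2).+1}| = (4 * h + 2).+1 ^ c.
  by rewrite card_ffun !card_ord.
apply: (@size_le_fibres _ _ key) => v.
have [/hasP[p p_route /eqP key_p]|] :=
    boolP (has (fun p => key p == v) (routes k h)); last first.
  by rewrite has_count lt0n negbK => /eqP->.
apply: leq_trans (fibre_bound (map f p) k_gt0 free_f).
have count_small x q : q \in routes k h -> count_mem x (map f q) < (4 * h + 2).+1.
  by move=> /size_route <-; rewrite ltnS -(size_map f) count_size.
rewrite -!size_filter; apply: size_subseq.
have -> : [seq q <- routes k h | key q == v]
        = [seq q <- [seq q <- routes k h | perm_eq (map f p) (map f q)] | key q == v].
  rewrite -filter_predI; apply: eq_in_filter => q q_route /=.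
  case: eqP => //= key_q; apply/esym/allP => x _ /=; apply/eqP.
  move: key_q; rewrite -key_p => /ffunP/(_ x); rewrite !ffunE.
  by move/(congr1 val); rewrite /= !inordK ?count_small.
exact: filter_subseq.
Qed.

(** With m = k-1, Bernoulli's inequality gives (m+1)^m >= 2 m^m, so for height
    mn the ratio (k/(k-1))^(mn) is at least 2^n, which for large n exceeds
    any fixed power of a linear function of n. *)
Lemma exponential_gap k c : 1 < k -> exists h, (4 * h.+1 + 3) ^ c * k.-1 ^ h.+1 < k ^ h.+1.
Proof.
case: k => // m; rewrite ltnS /= => m_gt0.
(* As n = 2^(2t), the linear bound 4mn+3 <= An is at most 2^(A+2t), so that
   c(A+2t) < 2^(2t) suffices; t is chosen such that c(A+2t) < (t+1)^2. *)
pose A := 4 * m + 3; pose t := A + 3 * c; pose n := 2 ^ (2 * t).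
have n_gt0 : 0 < n by rewrite expn_gt0.
exists (m * n).-1; rewrite prednK ?muln_gt0 ?m_gt0 //.
have double : 2 * m ^ m <= m.+1 ^ m.
  have bernoulli j : (m + j) * m ^ j <= m * m.+1 ^ j.
    elim: j => [|j IHj]; first by rewrite addn0.
    rewrite !expnS mulnCA [leqRHS]mulnCA.
    apply: leq_trans (leq_mul (leqnn m.+1) IHj); rewrite !mulnA leq_mul2r.
    apply/orP; right; nia.
  by rewrite -(leq_pmul2l m_gt0) mulnA muln2 -addnn bernoulli.
have poly_small : (4 * (m * n) + 3) ^ c < 2 ^ n.
  have le_An : 4 * (m * n) + 3 <= 2 ^ (A + 2 * t).
    rewrite expnD -/n; apply: (@leq_trans (A * n)); first by rewrite /A; nia.
    by rewrite leq_mul2r (ltnW (ltn_expl _ _)) ?orbT.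
  have [->|c_gt0] := posnP c; first by rewrite expn0 -[1]/(2 ^ 0) ltn_exp2l.
  apply: (@leq_ltn_trans ((2 ^ (A + 2 * t)) ^ c)); first by rewrite leq_exp2r.
  have lt_t := ltn_expl t (isT : 1 < 2).
  rewrite -expnM ltn_exp2l // /n mul2n -addnn expnD.
  apply: leq_trans (leq_mul lt_t lt_t); rewrite /t; nia.
apply: leq_trans (_ : 2 ^ n * m ^ (m * n) <= _); first by rewrite ltn_pmul2r ?expn_gt0 ?m_gt0.
by rewrite !expnM -expnMn leq_exp2r.
Qed.

Theorem theorem6 (k : nat) (hk : 2 <= k) (c : nat) (hc : 0 < c) :
  exists G : sgraph,
    max_degree G = k.+1 /\ c < anagram_free_chromatic_number hk G.
Proof.
have [h gap] := exponential_gap c hk.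
exists (lens_graph k h.+1); split; first exact: max_degree_lens.
rewrite /anagram_free_chromatic_number; case: ex_minnP => c' /asboolP[f free_f] _.
rewrite ltnNge; apply: contraL gap => le_c'c; rewrite -leqNgt.
apply: leq_trans (routes_le (ltnW hk) free_f) _.
by rewrite leq_mul2r leq_pexp2l ?orbT // addn3.
Qed.
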